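(* Let $A$ be a complex semisimple Banach algebra with identity and suppose that $\mathrm{Soc}\,A \neq \{0\}$. Then $A$ is prime if and only if for any $a, b \in A \setminus \{0\}$ the following two conditions are equivalent: (i) $\sigma'(ax) \subseteq \sigma'(bx)$ for all $x \in A$; (ii) $a = b$.
   Context: $\sigma(x)$ denotes the spectrum of $x \in A$ and $\sigma'(x) = \sigma(x) \setminus \{0\}$ its nonzero spectrum. $\mathrm{Soc}\,A$ is the socle of $A$ (the sum of the minimal left ideals of $A$, or $\{0\}$ if there are none); for semisimple $A$ it coincides with the set of $a \in A$ of finite rank, where $\mathrm{rank}(a) = \sup_{x \in A} \#\sigma'(xa)$. $A$ is prime if all nonzero two-sided ideals $I$ and $J$ of $A$ satisfy $IJ \neq \{0\}$. *)

(* Defs.v *)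
From HB Require Import structures.
From mathcomp Require Import all_boot all_order all_algebra.
From mathcomp Require Import complex.
From mathcomp Require Import all_classical all_reals all_analysis.

Set Implicit Arguments.
Unset Strict Implicit.
Unset Printing Implicit Defensive.

Import Order.TTheory GRing.Theory Num.Theory.
Import numFieldNormedType.Exports.

Local Open Scope classical_set_scope.
Local Open Scope ring_scope.

(* Unital Banach algebras over K. HB rejects a join of GRing.Algebra and
   CompleteNormedModule, so the multiplication is given as data on a complete
   normed module A, and the algebra structure is carried by the alias alg_of A
   of A (same carrier, same addition and scaling).
   `|one| = 1 is not required: it can always be arranged by passing to an
   equivalent submultiplicative norm. The condition one != 0, built into MathComp
   algebras, excludes only the zero algebra, whose socle is {0}. *)
HB.mixin Record CompleteNormedModule_isBanachAlgebra (K : numFieldType) A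
    & CompleteNormedModule K A := {
  banach_one : A;
  banach_mul : A -> A -> A;
  banach_one_neq0 : banach_one != 0;
  banach_mulA : associative banach_mul;
  banach_mul1x : left_id banach_one banach_mul;
  banach_mulx1 : right_id banach_one banach_mul;
  banach_mulDl : left_distributive banach_mul +%R;
  banach_mulDr : right_distributive banach_mul +%R;
  banach_scaleAl : forall (k : K) (x y : A),
    k *: banach_mul x y = banach_mul (k *: x) y;
  banach_scaleAr : forall (k : K) (x y : A),
    k *: banach_mul x y = banach_mul x (k *: y);
  banach_normM : forall x y : A, `|banach_mul x y| <= `|x| * `|y|
}.

#[short(type="banachAlgType")]
HB.structure Definition BanachAlgebra (K : numFieldType) :=
  {A of CompleteNormedModule K A & CompleteNormedModule_isBanachAlgebra K A}.

Section AlgOf.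
Variables (K : numFieldType) (A : banachAlgType K).

Definition alg_of : Type := A.

HB.instance Definition _ := GRing.Lmodule.on alg_of.
HB.instance Definition _ := GRing.Zmodule_isNzRing.Build alg_of
  (@banach_mulA K A) (@banach_mul1x K A) (@banach_mulx1 K A)
  (@banach_mulDl K A) (@banach_mulDr K A) banach_one_neq0.
HB.instance Definition _ := GRing.Lmodule_isLalgebra.Build K alg_of
  (@banach_scaleAl K A).
HB.instance Definition _ := GRing.Lalgebra_isAlgebra.Build K alg_of
  (@banach_scaleAr K A).

End AlgOf.

Section Rings.
Variable A : pzRingType.
Implicit Types (I J L M X : set A) (x y r : A).

Definition invertible x := exists y, y * x = 1 /\ x * y = 1.

Definition left_ideal L :=
  [/\ L 0, forall x y, L x -> L y -> L (x + y)
    & forall r x, L x -> L (r * x)].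

Definition two_sided_ideal I :=
  left_ideal I /\ forall r x, I x -> I (x * r).

Definition minimal_left_ideal L :=
  [/\ left_ideal L, L <> [set 0]
    & forall M, left_ideal M -> M `<=` L -> M = [set 0] \/ M = L].

Definition maximal_left_ideal L :=
  [/\ left_ideal L, L <> setT
    & forall M, left_ideal M -> L `<=` M -> M = L \/ M = setT].

Definition jacobson_radical : set A :=
  \bigcap_(L in [set L | maximal_left_ideal L]) L.

Definition semisimple := jacobson_radical = [set 0].

(* In particular finite_sums set0 = [set 0]. *)
Definition finite_sums X : set A :=
  [set x | exists s : seq A,
     (forall y, y \in s -> X y) /\ x = \sum_(y <- s) y].

Definition socle : set A :=
  finite_sums (\bigcup_(L in [set L | minimal_left_ideal L]) L).

Definition ideal_mul I J : set A :=
  finite_sums [set x * y | x in I & y in J].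

Definition prime_ring := forall I J,
  two_sided_ideal I -> two_sided_ideal J ->
  I <> [set 0] -> J <> [set 0] -> ideal_mul I J <> [set 0].

End Rings.

Arguments jacobson_radical : clear implicits.
Arguments semisimple : clear implicits.
Arguments socle : clear implicits.
Arguments prime_ring : clear implicits.

Definition spectrum (K : fieldType) (A : algType K) (x : A) : set K :=
  [set l | ~ invertible (l%:A - x)].

Definition nonzero_spectrum (K : fieldType) (A : algType K) (x : A) : set K :=
  spectrum x `\` [set 0].

(* Main.v *)
Require Import Defs.
From HB Require Import structures.
From mathcomp Require Import all_boot all_order all_algebra.
From mathcomp Require Import complex ring lra.
From mathcomp Require Import all_classical all_reals all_analysis.

Set Implicit Arguments.
Unset Strict Implicit.
Unset Printing Implicit Defensive.

Import Order.TTheory GRing.Theory Num.Theory.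
Import numFieldNormedType.Exports.

Local Open Scope classical_set_scope.
Local Open Scope ring_scope.

(** The algebraic heart of the theorem is a rank-one test. A semisimple ring is
semiprime, so a minimal left ideal is generated by an idempotent p for which
p A p is a division ring, and the Gelfand-Mazur theorem makes p A p = C p.
For x = u p v the nonzero spectrum of a x is that of p (v a u) p, which is a
scalar multiple f p of p: it is {f} if f <> 0 and empty otherwise. An inclusion
of nonzero spectra therefore says that, for all v and u, either
p v a u p = 0 or p v (a - b) u p = 0. A group is not the union of two proper
subgroups; used once in u and once in v, this shows that one of the two
expressions vanishes identically, and primeness turns this into a = 0 or
a = b ([spectral_inclusion_prime_eq]).

Conversely, if A is not prime, semiprimeness yields nonzero a and c with
a A c = c A a = 0. Then a x and c x annihilate each other, so that
(l - a x) (l - c x) = l (l - (a + c) x), and the nonzero spectrum of a x is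
included in that of (a + c) x although a <> a + c
([nonzero_spectrum_orthogonal]).

The analytic input is a proof of the Gelfand-Mazur theorem without complex
integration, valid in any normed algebra. If z in p A p were not a multiple of
p, its inverse u in the corner would make 1 - l u invertible for every l, with a
resolvent F bounded at infinity, and bounded on squares by compactness. The
claim is then Liouville's theorem for F, that is u = 0
([bounded_resolvent_eq0]). Averaging F over the points w l with w ^ N = 1, where
N = 2 ^ n, gives the inverse G of 1 - (l u) ^ N. These averages inherit from F
a bound and a Lipschitz constant which do not depend on N. If (r u) ^ N is small
then G is close to 1 at l = r, hence also at l = r + d for a d independent of r
and N, hence ((r + d) u) ^ N is small as well. By steps of length d this
reaches every radius. Since l u G is itself an average of w^-1 (F (w l) - 1) it
is bounded, and as G is close to 1 for a suitable N, r u is bounded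
independently of r. *)

(** * Semiprime rings, minimal left ideals and primeness *)

Section SemiprimeRings.
Variable A : pzRingType.
Implicit Types (I J L : set A) (x y z r : A).

(** If x lay outside a maximal left ideal L, then 1 = l + r x with l in L; but
r x squares to 0, so l = 1 - r x is a unit. *)
Lemma semisimple_semiprime x :
  semisimple A -> (forall r, x * r * x = 0) -> x = 0.
Proof.
move=> hss hx; suff: jacobson_radical A x by rewrite hss.
move=> L [[L0 LD LM] LT Lmax].
pose M := [set z : A | exists2 l, L l & exists r, z = l + r * x].
have LsubM : L `<=` M by move=> l Ll; exists l => //; exists 0; rewrite mul0r addr0.
have Mideal : left_ideal M.
  split; first exact: LsubM.
  - move=> _ _ [l Ll [r ->]] [l' Ll' [r' ->]].
    exists (l + l'); first exact: LD.
    by exists (r + r'); rewrite mulrDl addrACA.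
  - move=> s _ [l Ll [r ->]]; exists (s * l); first exact: LM.
    by exists (s * r); rewrite mulrDr mulrA.
have [ML|MT] := Lmax M Mideal LsubM.
  by rewrite -ML; exists 0 => //; exists 1; rewrite add0r mul1r.
have [l Ll [r lrx]] : M 1 by rewrite MT.
case: LT; apply/seteqP; split=> // z _.
have rx2 : r * x * (r * x) = 0 by rewrite -mulrA [x * _]mulrA hx mulr0.
have l1 : (1 + r * x) * l = 1.
  rewrite (_ : l = 1 - r * x); last by rewrite lrx addrK.
  by rewrite mulrBr mulr1 mulrDl mul1r rx2 addr0 addrK.
by rewrite -[z]mulr1 -l1 mulrA; apply: LM.
Qed.

(** Primeness is applied to the right annihilator J of x A and the left
annihilator of A J, which avoids describing the ideals generated by x and y. *)
Lemma prime_ring_elementwise x y :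
  prime_ring A -> (forall r, x * r * y = 0) -> x = 0 \/ y = 0.
Proof.
move=> hA hxy.
pose J := [set z | forall r, x * r * z = 0].
pose I := [set w | forall z r, J z -> w * r * z = 0].
have Jideal : two_sided_ideal J.
  split; first split.
  - by move=> r; rewrite mulr0.
  - by move=> z z' Jz Jz' r; rewrite mulrDr Jz Jz' addr0.
  - by move=> s z Jz r; rewrite mulrA -(mulrA x) Jz.
  - by move=> s z Jz r; rewrite mulrA Jz mul0r.
have Iideal : two_sided_ideal I.
  split; first split.
  - by move=> z r _; rewrite !mul0r.
  - by move=> w w' Iw Iw' z r Jz; rewrite !mulrDl Iw // Iw' // addr0.
  - by move=> s w Iw z r Jz; rewrite -!mulrA (mulrA w) Iw // mulr0.
  - by move=> s w Iw z r Jz; rewrite -(mulrA w) Iw.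
apply: contrapT => /not_orP[/eqP x0 /eqP y0].
apply: (hA I J Iideal Jideal).
- move=> I0; have : I x by move=> z r; exact.
  by rewrite I0 => /eqP; apply/negP.
- move=> J0; have : J y by [].
  by rewrite J0 => /eqP; apply/negP.
apply/seteqP; split=> [_ [s [sIJ ->]]|_ ->]; last first.
  by exists [::]; rewrite big_nil.
apply: big1_seq => z /sIJ[w Iw [w' Jw' <-]].
by rewrite -[w]mulr1; apply: Iw.
Qed.

Lemma two_sided_ideal_neq0 I :
  two_sided_ideal I -> I <> [set 0] -> exists2 x, I x & x != 0.
Proof.
move=> [[I0 _ _] _] nI; apply: contrapT => h; apply: nI.
apply/seteqP; split=> [x Ix|_ ->//]; apply: contrapT => /eqP x0.
by apply: h; exists x.
Qed.

Lemma ideal_mul_eq0 I J x y :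
  ideal_mul I J = [set 0] -> I x -> J y -> x * y = 0.
Proof.
move=> IJ0 Ix Jy; suff: ideal_mul I J (x * y) by rewrite IJ0.
exists [:: x * y]; rewrite big_seq1; split=> // z.
by rewrite mem_seq1 => /eqP ->; exists x => //; exists y.
Qed.

(** The second annihilation is where semisimplicity enters: with x A y = 0,
every y r x generates a nilpotent ideal. *)
Lemma orthogonal_elements_of_nonprime :
  semisimple A -> ~ prime_ring A ->
  exists x y, [/\ x != 0, y != 0, forall r, x * r * y = 0
                & forall r, y * r * x = 0].
Proof.
move=> hss nprime; apply: contrapT => noxy; apply: nprime => I J hI hJ nI nJ IJ0.
have [x Ix x0] := two_sided_ideal_neq0 hI nI.
have [y Jy y0] := two_sided_ideal_neq0 hJ nJ.
have xy r : x * r * y = 0 by apply: (ideal_mul_eq0 IJ0) => //; apply: hI.2.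
apply: noxy; exists x, y; split=> // r.
apply: semisimple_semiprime => // s.
by rewrite !mulrA -(mulrA (y * r)) -(mulrA (y * r)) xy mulr0 !mul0r.
Qed.

Lemma nonzero_socle_minimal_left_ideal :
  socle A <> [set 0] -> exists L, minimal_left_ideal L.
Proof.
move=> hsoc; apply: contrapT => h; apply: hsoc.
apply/seteqP; split=> [_ [s [hs ->]]|_ ->]; last by exists [::]; rewrite big_nil.
apply: big1_seq => z /hs[L hL _]; by case: h; exists L.
Qed.

Lemma sub_minimal_left_ideal L (M : set A) x :
  minimal_left_ideal L -> left_ideal M -> M `<=` L -> M x -> x != 0 -> M = L.
Proof.
move=> [_ _ Lmin] hM ML Mx x0; case: (Lmin M hM ML) => // M0.
by move: Mx x0; rewrite M0 => -> /eqP.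
Qed.

(** For an idempotent p: the corner p A p, a ring with unit p, is a division
ring. *)
Definition division_corner p :=
  forall z, p * z * p = z -> z != 0 ->
    exists w, [/\ p * w * p = w, w * z = p & z * w = p].

(** Brauer's lemma. Semiprimeness provides x in L with L x <> 0, hence L x = L
by minimality, and the p in L with x = p x is idempotent because x has no
nonzero left annihilator in L. A nonzero z in p A p generates L as a left ideal,
so it has a left inverse, and left inverses throughout make p A p a division
ring. *)
Lemma minimal_left_ideal_corner L :
  semisimple A -> minimal_left_ideal L ->
  exists p, [/\ p != 0, p * p = p & division_corner p].
Proof.
move=> hss hL; have [[L0 LD LM] nL _] := hL.
have mulL y : left_ideal [set z | exists2 l, L l & z = l * y].
  split; first by exists 0 => //; rewrite mul0r.
  - move=> _ _ [l Ll ->] [l' Ll' ->]; exists (l + l'); first exact: LD.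
    by rewrite mulrDl.
  - by move=> s _ [l Ll ->]; exists (s * l); [exact: LM|rewrite mulrA].
have [x Lx [l0 Ll0 l0x]] : exists2 x, L x & exists2 l, L l & l * x != 0.
  apply: contrapT => h; apply: nL; apply/seteqP; split=> [x Lx|_ ->//].
  apply: semisimple_semiprime => // r; apply: contrapT => /eqP hr.
  apply: h; exists (r * x); first exact: LM.
  by exists x; rewrite // mulrA.
have Lx_eq : [set z | exists2 l, L l & z = l * x] = L.
  apply: (@sub_minimal_left_ideal _ _ (l0 * x)) => //.
    by move=> _ [l _ ->]; apply: LM.
  by exists l0.
have [p Lp px] : [set z | exists2 l, L l & z = l * x] x by rewrite Lx_eq.
have p0 : p != 0.
  by apply: contraNneq l0x => p0; rewrite px p0 mul0r mulr0.
have ann0 l : L l -> l * x = 0 -> l = 0.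
  move=> Ll lx; apply: contrapT => /eqP l_neq0.
  suff annL : [set z | L z /\ z * x = 0] = L.
    have [_ l0x0] : [set z | L z /\ z * x = 0] l0 by rewrite annL.
    by rewrite l0x0 eqxx in l0x.
  apply: (@sub_minimal_left_ideal _ _ l) => //; last by move=> z [].
  split; first by rewrite /= mul0r.
  - by move=> y z [Ly yx] [Lz zx]; split; [exact: LD|rewrite mulrDl yx zx addr0].
  - by move=> s z [Lz zx]; split; [exact: LM|rewrite -mulrA zx mulr0].
have LN y : L y -> L (- y) by move=> Ly; rewrite -mulN1r; apply: LM.
have pp : p * p = p.
  apply/eqP; rewrite -subr_eq0; apply/eqP/ann0; last first.
    by rewrite mulrBl -mulrA -!px subrr.
  by apply: LD; [exact: LM|exact: LN].
have left_inv z : p * z * p = z -> z != 0 -> exists w, p * w * p = w /\ w * z = p.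
  move=> zE z0.
  have Lz : L z by rewrite -zE; apply: LM.
  have Az_eq : [set y | exists r, y = r * z] = L.
    apply: (@sub_minimal_left_ideal _ _ z) => //.
    - split; first by exists 0; rewrite mul0r.
      + by move=> _ _ [r ->] [s ->]; exists (r + s); rewrite mulrDl.
      + by move=> s _ [r ->]; exists (s * r); rewrite mulrA.
    - by move=> _ [r ->]; apply: LM.
    - by exists 1; rewrite mul1r.
  have [w pw] : [set y | exists r, y = r * z] p by rewrite Az_eq.
  exists (p * w * p); split; first by rewrite !mulrA pp -mulrA pp.
  have pz : p * z = z by rewrite -zE !mulrA pp.
  by rewrite -!mulrA pz -pw pp.
exists p; split=> // z zE z0.
have [w [wE wz]] := left_inv z zE z0.
have w0 : w != 0 by apply: contraNneq p0 => w0; rewrite -wz w0 mul0r.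
have [v [vE vw]] := left_inv w wE w0.
exists w; split=> //.
suff -> : z = v by [].
have pz : p * z = z by rewrite -zE !mulrA pp.
have vp : v * p = v by rewrite -vE -mulrA pp.
by rewrite -pz -vw -mulrA wz vp.
Qed.

End SemiprimeRings.

(** A group is not the union of two proper subgroups, here two kernels. *)
Lemma additive_cover (U V : zmodType) (f g : U -> V) :
  {morph f : u v / u + v} -> {morph g : u v / u + v} ->
  (forall u, f u = 0 \/ g u = 0) ->
  (forall u, f u = 0) \/ (forall u, g u = 0).
Proof.
move=> fD gD fg; apply: contrapT => /not_orP[/existsNP[u fu] /existsNP[v gv]].
have gu : g u = 0 by case: (fg u).
have fv : f v = 0 by case: (fg v).
case: (fg (u + v)); rewrite ?fD ?gD ?fv ?gu ?addr0 ?add0r; [exact: fu|exact: gv].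
Qed.

(** * Nonzero spectra and rank-one elements *)

Section Spectrum.
Variables (K : fieldType) (A : algType K).
Implicit Types (x y p q c d : A) (l : K).

Lemma invertible_of_onesided x y z : y * x = 1 -> x * z = 1 -> invertible x.
Proof.
move=> yx xz; exists y; split=> //.
suff -> : y = z by [].
by rewrite -[y]mulr1 -xz mulrA yx mul1r.
Qed.

Lemma nonzero_spectrum_orthogonal p q :
  p * q = 0 -> q * p = 0 -> nonzero_spectrum p `<=` nonzero_spectrum (p + q).
Proof.
move=> pq qp l [lp /eqP l0]; split; last exact/eqP.
move=> [w [wpq pqw]]; apply: lp.
have factor x y : x * y = 0 ->
    (l%:A - x) * (l%:A - y) = l *: (l%:A - (x + y)).
  move=> xy; rewrite mulrBl !mulrBr xy subr0 -[x * _]scalerAr mulr1.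
  by rewrite -!scalerAl !mul1r -!scalerBr opprD addrA addrAC.
apply: (@invertible_of_onesided _ (l^-1 *: (w * (l%:A - q)))
          (l^-1 *: ((l%:A - q) * w))).
- by rewrite -scalerAl -mulrA factor // -scalerAr (addrC q) wpq scalerA mulVf ?scale1r.
- by rewrite -scalerAr mulrA factor // -scalerAl pqw scalerA mulVf ?scale1r.
Qed.

(** The inverse of l - cd is l^-1 (1 + c w d), where w inverts l - dc. *)
Lemma invertible_swap l c d :
  l != 0 -> invertible (l%:A - d * c) -> invertible (l%:A - c * d).
Proof.
move=> l0 [w [wdc dcw]].
have comm y : l%:A * y = y * l%:A :> A by rewrite -scalerAl -scalerAr mul1r mulr1.
have cd_d : (l%:A - c * d) * c = c * (l%:A - d * c).
  by rewrite mulrBl mulrBr comm mulrA.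
have d_cd : d * (l%:A - c * d) = (l%:A - d * c) * d.
  by rewrite mulrBl mulrBr comm mulrA.
exists (l^-1 *: (1 + c * w * d)); split.
- rewrite -scalerAl mulrDl mul1r -(mulrA (c * w)) d_cd mulrA -(mulrA c) wdc mulr1 subrK.
  by rewrite scalerA mulVf ?scale1r.
- rewrite -scalerAr mulrDr mulr1 !mulrA cd_d -!mulrA (mulrA _ w) dcw mul1r subrK.
  by rewrite scalerA mulVf ?scale1r.
Qed.

Lemma nonzero_spectrumC c d : nonzero_spectrum (c * d) = nonzero_spectrum (d * c).
Proof.
apply/seteqP; split=> l [nl /eqP l0];
  (split; [by move/(invertible_swap l0)|exact/eqP]).
Qed.

Lemma nonzero_spectrum_scaled_idempotent p l :
  p != 0 -> p * p = p -> nonzero_spectrum (l *: p) = [set l] `\` [set 0].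
Proof.
move=> p0 pp; apply/seteqP; split=> [m [nm m0]|_ [-> /= /eqP l0]].
  split=> //=; apply: contrapT => /eqP ml; apply: nm.
  have {}m0 : m != 0 by apply/eqP.
  have ml0 : m - l != 0 by rewrite subr_eq0.
  pose w := (m - l)^-1 *: p + m^-1 *: (1 - p).
  have pq : p * (1 - p) = 0 by rewrite mulrBr mulr1 pp subrr.
  have qp : (1 - p) * p = 0 by rewrite mulrBl mul1r pp subrr.
  have qq : (1 - p) * (1 - p) = 1 - p by rewrite mulrBr mulr1 qp subr0.
  have -> : m%:A - l *: p = (m - l) *: p + m *: (1 - p).
    by rewrite scalerBl scalerBr [RHS]addrC addrA subrK.
  exists w; split; rewrite mulrDl !mulrDr -!scalerAl -!scalerAr !scalerA.
    by rewrite pp qq pq qp !scaler0 addr0 add0r !mulVf // !scale1r addrC subrK.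
  by rewrite pp qq pq qp !scaler0 addr0 add0r !divff // !scale1r addrC subrK.
split; last exact/eqP.
move=> [w [wp _]]; case/eqP: p0.
rewrite -[p]mul1r -wp -mulrA mulrBl -scalerAl mul1r -scalerAl pp subrr.
by rewrite mulr0.
Qed.

Definition scalar_corner p := forall z, exists l, p * z * p = l *: p.

(** Testing the inclusion on the rank-one elements x = u p v turns it into an
alternative between two biadditive maps of (v, u). *)
Lemma spectral_inclusion_prime_eq a b p :
  prime_ring A -> p != 0 -> p * p = p -> scalar_corner p -> a != 0 ->
  (forall x, nonzero_spectrum (a * x) `<=` nonzero_spectrum (b * x)) -> a = b.
Proof.
move=> hA p0 pp hp a0 hab.
have prime0 x : (forall u, p * x * u * p = 0) -> p * x = 0.
  by move=> /(prime_ring_elementwise hA)[//|/eqP]; rewrite (negPf p0).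
have prime0l x : (forall v, p * v * x = 0) -> x = 0.
  by move=> /(prime_ring_elementwise hA)[/eqP|//]; rewrite (negPf p0).
have spec x u v l : p * (v * x * u) * p = l *: p ->
    nonzero_spectrum (x * (u * p * v)) = [set l] `\` [set 0].
  move=> xl; rewrite (_ : x * _ = (x * u * p) * (p * v)); last first.
    by rewrite -!mulrA (mulrA p p) pp.
  by rewrite nonzero_spectrumC -(nonzero_spectrum_scaled_idempotent l p0 pp) -xl !mulrA.
(* The scalars l and m of p v a u p and p v b u p can differ only if l = 0. *)
have key v u : p * v * a * u * p = 0 \/ p * v * (a - b) * u * p = 0.
  have [l al] := hp (v * a * u); have [m bm] := hp (v * b * u).
  have [l0|l0] := eqVneq l 0; first by left; move: al; rewrite !mulrA l0 scale0r.
  right; have : nonzero_spectrum (b * (u * p * v)) l.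
    by apply: hab; rewrite (spec _ _ _ _ al); split=> //; exact/eqP.
  rewrite (spec _ _ _ _ bm) => -[/= lm _].
  by rewrite mulrBr !mulrBl -!mulrA !mulrA in al bm *; rewrite al bm lm subrr.
have key_v v : p * v * a = 0 \/ p * v * (a - b) = 0.
  suff [h|h] : (forall u, p * v * a * u * p = 0) \/
               (forall u, p * v * (a - b) * u * p = 0).
  - by left; rewrite -mulrA; apply: prime0 => u; rewrite !mulrA.
  - by right; rewrite -mulrA; apply: prime0 => u; rewrite mulrA h.
  by apply: additive_cover (key v) => x y; rewrite (mulrDr _ x y) (mulrDl (_ * x)).
have [h|h] : (forall v, p * v * a = 0) \/ (forall v, p * v * (a - b) = 0).
- by apply: additive_cover key_v => x y; rewrite (mulrDr _ x y) (mulrDl (_ * x)).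
- by move: a0; rewrite (prime0l _ h) eqxx.
- by apply/eqP; rewrite -subr_eq0 (prime0l _ h).
Qed.

End Spectrum.

(** * The modulus of a complex number as a real number *)

Notation cabs := (@ComplexField.Normc.normc _).

Section ComplexModulus.
Variable R : realType.
Implicit Types (k : R[i]) (r : R).

Lemma cabsE k : `|k| = (cabs k)%:C%C.
Proof. by []. Qed.

Lemma cabs_ge0 k : 0 <= cabs k.
Proof. by rewrite -(@lecR R) -cabsE normr_ge0. Qed.

Lemma cabs_real r : cabs r%:C%C = `|r|.
Proof. by rewrite /= expr0n /= addr0 sqrtr_sqr. Qed.

Lemma cabs_le_ReIm k : cabs k <= `|complex.Re k| + `|complex.Im k|.
Proof.
case: k => a b /=; rewrite -(@ler_pXn2r _ 2) ?nnegrE ?sqrtr_ge0 ?addr_ge0 //.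
rewrite sqr_sqrtr ?addr_ge0 ?sqr_ge0 // -(real_normK (num_real a)).
rewrite -(real_normK (num_real b)).
rewrite sqrrD -addrA lerD2l lerDr mulrn_wge0 // mulr_ge0.
Qed.

Lemma ReIm_le_cabs k : `|complex.Re k| <= cabs k /\ `|complex.Im k| <= cabs k.
Proof.
case: k => a b /=; split; rewrite -sqrtr_sqr ler_sqrt ?addr_ge0 ?sqr_ge0 //.
  by rewrite lerDl sqr_ge0.
by rewrite lerDr sqr_ge0.
Qed.

End ComplexModulus.

(** * Liouville's theorem for resolvents, by averages over roots of unity *)

Section NormedAlgebra.
Variables (R : realType) (B : algType R[i]) (nrm : B -> R).

(** A norm with values in R rather than R[i], so that inequalities between norms
live in a totally ordered field. *)
Definition algebra_norm :=
  [/\ forall x, nrm x = 0 -> x = 0,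
      forall x y, nrm (x + y) <= nrm x + nrm y,
      forall (k : R[i]) x, nrm (k *: x) = cabs k * nrm x
    & forall x y, nrm (x * y) <= nrm x * nrm y].

Hypothesis hnrm : algebra_norm.
Implicit Types (u x y z : B) (k l m : R[i]).

Let nrm_eq0 : forall x, nrm x = 0 -> x = 0. Proof. by case: hnrm. Qed.
Let nrmD : forall x y, nrm (x + y) <= nrm x + nrm y. Proof. by case: hnrm. Qed.
Let nrmZ : forall k x, nrm (k *: x) = cabs k * nrm x. Proof. by case: hnrm. Qed.
Let nrmM : forall x y, nrm (x * y) <= nrm x * nrm y. Proof. by case: hnrm. Qed.

Let nrm0 : nrm 0 = 0.
Proof. by rewrite -(scale0r 0) nrmZ ComplexField.Normc.normc0 mul0r. Qed.

Let nrmN x : nrm (- x) = nrm x.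
Proof. by rewrite -scaleN1r nrmZ (normcN 1) ComplexField.Normc.normc1 mul1r. Qed.

Let nrmB x y : nrm (x - y) <= nrm x + nrm y.
Proof. by rewrite -(nrmN y) nrmD. Qed.

Let nrm_ge0 x : 0 <= nrm x.
Proof. by have := nrmB x x; rewrite subrr nrm0; lra. Qed.

Section Resolvent.
Variables (u : B) (F : R[i] -> B).

(** The resolvent of u read at 1/l: it is defined at 0 and the hypothesis says
that u has no nonzero spectral value. *)
Definition resolvent_of :=
  forall l, (1 - l *: u) * F l = 1 /\ F l * (1 - l *: u) = 1.

Hypothesis hF : resolvent_of.

Lemma resolvent_identity l m : F l - F m = (l - m) *: (F l * u * F m).
Proof.
have [_ Fl] := hF l; have [Fm _] := hF m.
have {1}-> : F l = F l * (1 - m *: u) * F m by rewrite -mulrA Fm mulr1.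
have {2}-> : F m = F l * (1 - l *: u) * F m by rewrite Fl mul1r.
rewrite -mulrBl -mulrBr scalerAl scalerAr; congr (_ * _ * _).
by rewrite opprB addrC subrKA -scalerBl.
Qed.

(** The resolvent identity makes F locally bounded. No Neumann series is
involved because F is already known to exist around m. *)
Lemma resolvent_near l m :
  cabs (l - m) * (nrm u * nrm (F m)) <= 2^-1 -> nrm (F l) <= 2 * nrm (F m).
Proof.
move=> h; have /(congr1 nrm) := resolvent_identity l m.
rewrite nrmZ => e.
have h1 : nrm (F l * u * F m) <= nrm (F l) * (nrm u * nrm (F m)).
  apply: le_trans (nrmM _ _) _; rewrite mulrA ler_wpM2r //.
have h2 : nrm (F l) <= nrm (F l - F m) + nrm (F m) by rewrite -{1}(subrK (F m) (F l)).
have h3 := ler_wpM2l (cabs_ge0 (l - m)) h1.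
have h4 := ler_wpM2r (nrm_ge0 (F l)) h.
rewrite e in h2.
have : cabs (l - m) * (nrm (F l) * (nrm u * nrm (F m))) =
  cabs (l - m) * (nrm u * nrm (F m)) * nrm (F l) by ring.
by lra.
Qed.

Lemma resolvent_bounded_square (rho : R) :
  exists M, forall l,
    `|complex.Re l| <= rho -> `|complex.Im l| <= rho -> nrm (F l) <= M.
Proof.
pose K := (`[- rho, rho] `*` `[- rho, rho] : set (R * R)).
have Kc : compact K by apply: compact_setX; apply: segment_compact.
move/compact_near_coveringP: Kc => /(_ R (pinfty_nbhs R)
  (fun M ab => nrm (F (ab.1 +i* ab.2)%C) <= M)) Kcov.
have [] : \forall M \near +oo, K `<=` (fun ab => nrm (F (ab.1 +i* ab.2)%C) <= M).
  apply: Kcov => -[a b] _.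
  pose m := (a +i* b)%C.
  pose C := nrm u * nrm (F m) + 1.
  have C0 : 0 < C by rewrite ltr_wpDl // mulr_ge0.
  (* The modulus is at most the sum of the real and imaginary parts, whence a
     radius (4 C)^-1 in each coordinate for the radius (2 C)^-1 of
     [resolvent_near]. *)
  have e0 : 0 < (4 * C)^-1 by rewrite invr_gt0 mulr_gt0.
  exists ([set ab : R * R | `|a - ab.1| < (4 * C)^-1 /\ `|b - ab.2| < (4 * C)^-1],
          [set M | 2 * nrm (F m) < M]).
    split => /=.
      exists ([set a' | `|a - a'| < (4 * C)^-1], [set b' | `|b - b'| < (4 * C)^-1]).
        by split; apply/nbhs_ballP; exists (4 * C)^-1.
      by move=> [a' b'] [].
    by exists (2 * nrm (F m)); split => //; exact: num_real.
  move=> [[a' b'] M] /= [[ha hb] hM]; apply: le_trans (ltW hM).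
  apply: resolvent_near.
  have hl := cabs_le_ReIm ((a' +i* b')%C - m); rewrite /= in hl.
  rewrite distrC in ha; rewrite distrC in hb.
  have hl2 : cabs ((a' +i* b')%C - m) <= (2 * C)^-1.
    rewrite (_ : (2 * C)^-1 = (4 * C)^-1 + (4 * C)^-1).
      by apply: (le_trans hl); apply: lerD; exact: ltW.
    by field; apply: lt0r_neq0.
  apply: (@le_trans _ _ ((2 * C)^-1 * C)).
    apply: ler_pM; rewrite ?cabs_ge0 ?mulr_ge0 //.
    by rewrite lerDl.
  by rewrite le_eqVlt; apply/orP; left; apply/eqP; field; apply: lt0r_neq0.
move=> M [_ hM]; exists (M + 1) => -[a b] ha hb.
by apply: (hM (M + 1) _ (a, b)); [rewrite ltrDl|split; rewrite /= in_itv /= -ler_norml].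
Qed.

Lemma resolvent_bounded (rho C : R) :
  (forall l, rho <= cabs l -> nrm (F l) <= C) ->
  exists M, forall l, nrm (F l) <= M.
Proof.
move=> hC; have [M hM] := resolvent_bounded_square rho.
exists (Num.max M C) => l; rewrite le_max.
have [h|h] := leP rho (cabs l); first by rewrite hC ?orbT.
have [hr hi] := ReIm_le_cabs l.
by rewrite hM // ltW // (le_lt_trans _ h).
Qed.

Variable M : R.
Hypothesis FM : forall l, nrm (F l) <= M.

(** Multiplication by this root permutes the 2 ^ n.+1-th roots of unity and
exchanges those that are 2 ^ n-th roots with those that are not. *)
Definition neg_one_root n : R[i] := (2 ^ n)%N.-root (-1).

Lemma neg_one_rootX n : neg_one_root n ^+ (2 ^ n) = -1.
Proof. by rewrite rootCK ?expn_gt0. Qed.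

Lemma cabs_neg_one_root n : cabs (neg_one_root n) = 1.
Proof.
suff : `|neg_one_root n| = 1 by rewrite cabsE => -[].
by rewrite norm_rootC normrN1 rootC1 // expn_gt0.
Qed.

(** The mean of F (w l) over the 2 ^ n-th roots of unity w. Only powers of two
are used, because then each mean is the half-sum of two previous ones, and
every estimate below follows by induction through [nrm_half_sum]. *)
Fixpoint resolvent_mean n l : B :=
  if n is n'.+1 then
    2^-1 *: (resolvent_mean n' l + resolvent_mean n' (neg_one_root n' * l))
  else F l.

(** With v = (l u) ^ (2 ^ n), this is 1/(1 - v) + 1/(1 + v) = 2/(1 - v ^ 2). *)
Lemma resolvent_meanP n l :
  (1 - (l *: u) ^+ (2 ^ n)) * resolvent_mean n l = 1.
Proof.
elim: n l => [|n IH] l /=; first by rewrite expr1; case: (hF l).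
set v := (l *: u) ^+ (2 ^ n).
have vX : (l *: u) ^+ (2 ^ n.+1) = v * v by rewrite expnS mulnC exprM expr2.
have IH2 := IH (neg_one_root n * l).
rewrite -scalerA exprZn neg_one_rootX scaleN1r opprK in IH2.
have f1 : 1 - v * v = (1 + v) * (1 - v).
  by rewrite mulrDl mul1r mulrBr mulr1 addrA subrK.
have f2 : 1 - v * v = (1 - v) * (1 + v).
  by rewrite mulrBl mul1r mulrDr mulr1 opprD addrA addrK.
rewrite vX -scalerAr mulrDr {1}f1 f2 -!mulrA (IH l) IH2 !mulr1.
rewrite addrACA subrr addr0 -mulr2n -(@scaler_nat _ B).
by rewrite scalerA mulVf ?scale1r ?pnatr_eq0.
Qed.

Lemma nrm_half_sum x y (b : R) :
  nrm x <= b -> nrm y <= b -> nrm (2^-1 *: (x + y)) <= b.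
Proof.
move=> hx hy; rewrite nrmZ.
have -> : cabs (2^-1 : R[i]) = 2^-1.
  rewrite ComplexField.Normc.normcV; congr _^-1.
  by rewrite (_ : 2 = (2 : R)%:C%C) ?cabs_real ?normr_nat // rmorph_nat.
by have := nrmD x y; lra.
Qed.

Lemma resolvent_mean_bound n l : nrm (resolvent_mean n l) <= M.
Proof. by elim: n l => [|n IH] l //=; apply: nrm_half_sum. Qed.

Lemma resolvent_mean_lipschitz n l m :
  nrm (resolvent_mean n l - resolvent_mean n m) <= M * nrm u * M * cabs (l - m).
Proof.
have M0 : 0 <= M := le_trans (nrm_ge0 _) (FM 0).
elim: n l m => [|n IH] l m /=.
  rewrite resolvent_identity nrmZ mulrC ler_wpM2r ?cabs_ge0 //.
  apply: le_trans (nrmM _ _) _; apply: ler_pM => //.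
  by apply: le_trans (nrmM _ _) _; rewrite ler_wpM2r.
rewrite -scalerBr opprD addrACA; apply: nrm_half_sum => //.
apply: le_trans (IH _ _) _.
by rewrite -mulrBr ComplexField.Normc.normcM cabs_neg_one_root mul1r.
Qed.

(** A discrete Cauchy estimate: l u G is the mean of w^-1 (F (w l) - 1) over the
roots of unity w, and l u F l = F l - 1 starts the induction. *)
Lemma resolvent_mean_first_coef n l :
  nrm (l *: u * resolvent_mean n l) <= M + nrm 1.
Proof.
elim: n l => [|n IH] l /=.
  have [e _] := hF l.
  rewrite (_ : l *: u * F l = F l - 1); last first.
    by rewrite -e mulrBl mul1r opprB addrC subrK.
  by apply: le_trans (nrmB _ _) _; rewrite lerD2r.
rewrite -scalerAr mulrDr; apply: nrm_half_sum => //.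
have := IH (neg_one_root n * l).
by rewrite -scalerA -scalerAl nrmZ cabs_neg_one_root mul1r.
Qed.

(** Equivalent to r being smaller than the inverse of the spectral radius of u:
once one power has norm below 1, its iterated squares tend to 0. *)
Definition power_decays (r : R) :=
  exists n, nrm ((r%:C%C *: u) ^+ (2 ^ n)) <= 2^-1.

Lemma power_decays_small r (e : R) : 0 < e -> power_decays r ->
  exists n, nrm ((r%:C%C *: u) ^+ (2 ^ n)) <= e.
Proof.
move=> e0 [n hn].
have h j : nrm ((r%:C%C *: u) ^+ (2 ^ (n + j))) <= 2^-1 ^+ j.+1.
  elim: j => [|j IH]; first by rewrite addn0 expr1.
  rewrite addnS expnS mulnC exprM expr2; apply: le_trans (nrmM _ _) _.
  rewrite exprS; apply: ler_pM => //; apply: le_trans IH _.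
  by rewrite exprS ler_piMr ?exprn_ile1 ?invr_ge0 ?invf_le1 ?ler1n.
pose k := Num.bound e^-1.
have hk : e^-1 < k%:R by apply: archi_boundP; rewrite invr_ge0 ltW.
exists (n + k)%N; apply: le_trans (h k) _.
rewrite exprVn invf_ple ?posrE ?exprn_gt0 //; apply: le_trans (ltW hk) _.
by rewrite -natrX ler_nat ltnW // (leq_trans (ltn_expl k (ltnSn 1))) // leq_exp2l.
Qed.

(* The Lipschitz constant of [resolvent_mean_lipschitz]. *)
Let L := M * nrm u * M.

Lemma resolvent_mean_near1 r (e : R) : 0 < e -> power_decays r ->
  exists n, nrm (resolvent_mean n r%:C%C - 1) <= e.
Proof.
have M0 : 0 <= M := le_trans (nrm_ge0 _) (FM 0).
have M1 : 0 < M + 1 by lra.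
move=> e0 /(power_decays_small (divr_gt0 e0 M1))[n hn]; exists n.
have := resolvent_meanP n r%:C%C; set G := resolvent_mean _ _; set v := _ ^+ _ => hG.
have -> : G - 1 = v * G by rewrite -hG mulrBl mul1r opprB addrC subrK.
apply: le_trans (nrmM _ _) _; apply: (@le_trans _ _ (e / (M + 1) * (M + 1))).
  apply: ler_pM => //; apply: le_trans (resolvent_mean_bound _ _) _.
  by rewrite lerDl.
by rewrite divfK // lt0r_neq0.
Qed.

(** The length d of the step depends neither on r nor on the exponent, thanks to
the uniform Lipschitz constant L of the means. *)
Lemma power_decays_step r (d : R) : 0 <= d -> d * L <= 6^-1 ->
  power_decays r -> power_decays (r + d).
Proof.
move=> d0 dL /(@resolvent_mean_near1 _ 6^-1)[|n hn]; first by rewrite invr_gt0.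
exists n; have := resolvent_meanP n (r + d)%:C%C.
set v := _ ^+ _; set G := resolvent_mean _ _ => hG.
have hG1 : nrm (G - 1) <= 3^-1.
  rewrite -(subrKA (resolvent_mean n r%:C%C)).
  have h1 := nrmD (G - resolvent_mean n r%:C%C) (resolvent_mean n r%:C%C - 1).
  have := resolvent_mean_lipschitz n (r + d)%:C%C r%:C%C.
  rewrite -/G -/L -rmorphB addrAC subrr add0r cabs_real ger0_norm // => h2.
  by rewrite mulrC in dL; lra.
have e1 : G - 1 = v * G by rewrite -hG mulrBl mul1r opprB addrC subrK.
(* So nrm v <= 1/3 + nrm v / 3, that is nrm v <= 1/2. *)
have e2 : v = (G - 1) - v * (G - 1) by rewrite mulrBr mulr1 {1}e1 opprB addrC subrK.
have h1 := nrmB (G - 1) (v * (G - 1)); rewrite -e2 in h1.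
have h2 := nrmM v (G - 1).
have h3 := ler_wpM2l (nrm_ge0 v) hG1.
by lra.
Qed.

(** Liouville's theorem for resolvents. All radii d j are reached by steps of
length d; at each of them some mean G is within 1/2 of 1, so the bound on l u G
bounds l u independently of l = d j. *)
Lemma bounded_resolvent_eq0 : u = 0.
Proof.
have M0 : 0 <= M := le_trans (nrm_ge0 _) (FM 0).
have L0 : 0 <= L by rewrite !mulr_ge0.
pose d := (6 * (L + 1))^-1.
have d0 : 0 < d by rewrite invr_gt0 mulr_gt0 //; lra.
have dL : d * L <= 6^-1.
  rewrite /d invfM -mulrA ler_piMr // ?invr_ge0 //.
  by rewrite mulrC ler_pdivrMr; lra.
have decays j : power_decays (d * j%:R).
  elim: j => [|j IH]; first by exists 0%N; rewrite mulr0 scale0r expr1 nrm0 invr_ge0.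
  by rewrite -natr1 mulrDr mulr1; apply: power_decays_step => //; exact: ltW.
have bound j : (d * j%:R) * nrm u <= 2 * (M + nrm 1).
  have [|n hn] := @resolvent_mean_near1 _ 2^-1 _ (decays j); first by rewrite invr_gt0.
  have h1 := resolvent_mean_first_coef n (d * j%:R)%:C%C.
  set x := _ *: u in h1; set G := resolvent_mean _ _ in hn h1.
  have hx : nrm x = d * j%:R * nrm u.
    by rewrite nrmZ cabs_real ger0_norm // mulr_ge0 // ltW.
  rewrite -hx.
  have e : x = x * G - x * (G - 1) by rewrite mulrBr mulr1 opprB addrC subrK.
  have h2 := nrmB (x * G) (x * (G - 1)); rewrite -e in h2.
  have h3 := nrmM x (G - 1); have h4 := ler_wpM2l (nrm_ge0 x) hn.
  by lra.
apply: nrm_eq0; apply/eqP; rewrite eq_le nrm_ge0 andbT leNgt; apply/negP => u0.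
have du0 : 0 < d * nrm u by rewrite mulr_gt0.
have T0 : 0 <= 2 * (M + nrm 1) / (d * nrm u).
  by rewrite divr_ge0 ?mulr_ge0 ?addr_ge0 // ltW.
have := archi_boundP T0; set k := Num.bound _.
rewrite ltr_pdivrMr // => hk; have := bound k.
have -> : d * k%:R * nrm u = k%:R * (d * nrm u) by ring.
by lra.
Qed.

End Resolvent.

(** Gelfand-Mazur for a corner. If x in p A p is not a multiple of p, its inverse
u in the corner satisfies x (p - l u) = x - l p, so p - l u is nonzero, with an
inverse w l in the corner, and 1 - p + w l inverts 1 - l u in the whole algebra.
From l w = w x - x, w tends to 0 at infinity, so this resolvent is bounded and
Liouville's theorem gives u = 0. *)
Lemma normed_division_corner_scalar p :
  p != 0 -> p * p = p -> division_corner p ->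
  @scalar_corner _ B p.
Proof.
move=> p0 pp hp z0; set x := p * z0 * p.
have xE : p * x * p = x by rewrite /x !mulrA pp -!mulrA pp.
have px : p * x = x by rewrite /x !mulrA pp.
have xp : x * p = x by rewrite /x -mulrA pp.
apply: contrapT => /forallNP hx.
have x0 : x != 0 by apply/eqP => x0; apply: (hx 0); rewrite x0 scale0r.
have [u [uE ux xu]] := hp x xE x0.
have pu : p * u = u by rewrite -uE !mulrA pp.
have up : u * p = u by rewrite -uE -mulrA pp.
have pu0 l : p - l *: u != 0.
  apply/eqP => e; have l0 : l != 0.
    by apply: contraNneq p0 => l0; move: e; rewrite l0 scale0r subr0 => ->.
  apply: (hx l); have /(congr1 (fun y => x * y)) : p - l *: u = 0 by [].
  by rewrite mulrBr mulr0 -scalerAr xp xu => /eqP; rewrite subr_eq0 => /eqP.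
have /choice[w hw] l : exists w,
    [/\ p * w * p = w, w * (p - l *: u) = p & (p - l *: u) * w = p].
  apply: hp (pu0 l).
  by rewrite mulrBr mulrBl -scalerAr -scalerAl pp pp uE.
pose F l := (1 - p) + w l.
have hF : resolvent_of u F.
  move=> l; have [wE wl lw] := hw l.
  have pw : p * w l = w l by rewrite -wE !mulrA pp.
  have wp : w l * p = w l by rewrite -wE -mulrA pp.
  have -> : 1 - l *: u = (1 - p) + (p - l *: u) by rewrite addrA subrK.
  have pq : p * (1 - p) = 0 by rewrite mulrBr mulr1 pp subrr.
  have qp : (1 - p) * p = 0 by rewrite mulrBl mul1r pp subrr.
  have qq : (1 - p) * (1 - p) = 1 - p by rewrite mulrBr mulr1 qp subr0.
  have qw : (1 - p) * w l = 0 by rewrite -pw mulrA qp mul0r.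
  have wq : w l * (1 - p) = 0 by rewrite -wp -mulrA pq mulr0.
  have qu : (1 - p) * (p - l *: u) = 0.
    by rewrite mulrBr qp -scalerAr -pu mulrA qp mul0r scaler0 subrr.
  have uq : (p - l *: u) * (1 - p) = 0.
    by rewrite mulrBl pq -scalerAl -up -mulrA pq mulr0 scaler0 subrr.
  rewrite /F; move: (1 - p) (p - l *: u) (subrK p 1) qq qw wq qu uq wl lw.
  move=> q v q1 qq qw wq qv vq wv vw; split; rewrite mulrDl !mulrDr qq.
  - by rewrite qw vq vw addr0 add0r.
  - by rewrite wq qv wv addr0 add0r.
have u0 : u != 0 by apply: contraNneq p0 => u0; rewrite -ux u0 mul0r.
suff [M hM] : exists M, forall l, nrm (F l) <= M.
  by case/eqP: u0; apply: bounded_resolvent_eq0 hF M hM.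
apply: (@resolvent_bounded u F hF (2 * nrm x + 1) (nrm (1 - p) + 2 * nrm x)) => l hl.
apply: le_trans (nrmD _ _) _; rewrite lerD2l.
have [_ wl _] := hw l.
have := congr1 (fun y => y * x) wl.
rewrite /= px -mulrA mulrBl px -scalerAl ux => hwx.
have e : l *: w l = w l * x - x. 
  rewrite -{2}hwx mulrBr -scalerAr opprB addrC subrK.
  by have [wE _ _] := hw l; rewrite -wE -(mulrA (_ * _)) pp.
have h1 := nrmB (w l * x) x; rewrite -e nrmZ in h1.
have h2 := nrmM (w l) x.
have h3 := ler_wpM2r (nrm_ge0 (w l)) hl.
have h4 : 0 <= nrm (w l) := nrm_ge0 _.
have h5 : 0 <= nrm x := nrm_ge0 _.
nra.
Qed.

End NormedAlgebra.

(** * The characterization of primeness *)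

Lemma banach_algebra_norm (R : realType) (A : banachAlgType R[i]) :
  algebra_norm (fun x : alg_of A => complex.Re `|x : A|).
Proof.
have normE (x : A) : `|x| = (complex.Re `|x|)%:C%C.
  by rewrite RRe_real ?ger0_real.
split=> [x x0|x y|k x|x y].
- by apply/(@normr0_eq0 _ A); rewrite normE x0.
- have := @ler_normD _ A x y.
  by rewrite (normE (x + y)) (normE x) (normE y) -rmorphD lecR.
- have := @normrZ _ A k x; rewrite (normE (k *: x)) (normE x) cabsE -rmorphM.
  by case.
- have := @banach_normM _ A x y.
  by rewrite (normE (banach_mul x y)) (normE x) (normE y) -rmorphM lecR.
Qed.

Theorem theorem2p17 (R : realType) (A : banachAlgType R[i])
    (hss : semisimple (alg_of A)) (hsoc : socle (alg_of A) <> [set 0]) :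
  prime_ring (alg_of A) <->
  (forall a b : alg_of A, a != 0 -> b != 0 ->
     ((forall x : alg_of A, nonzero_spectrum (a * x) `<=` nonzero_spectrum (b * x))
      <-> a = b)).
Proof.
split=> [hprime a b a0 b0|hab].
  split=> [hspec|-> x l //].
  have [L hL] := nonzero_socle_minimal_left_ideal hsoc.
  have [p [p0 pp hp]] := minimal_left_ideal_corner hss hL.
  have hscalar := normed_division_corner_scalar (banach_algebra_norm A) p0 pp hp.
  exact: spectral_inclusion_prime_eq hprime p0 pp hscalar a0 hspec.
apply: contrapT => nprime.
have [a [c [a0 c0 ac ca]]] := orthogonal_elements_of_nonprime hss nprime.
have ac0 : a + c != 0.
  apply: contraNneq a0 => /eqP; rewrite addr_eq0 => /eqP aE.
  apply/eqP/semisimple_semiprime => // r.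
  by rewrite {2}aE mulrN ac oppr0.
have : a = a + c.
  apply: (hab a (a + c) a0 ac0).1 => x; rewrite mulrDl.
  by apply: nonzero_spectrum_orthogonal; rewrite mulrA ?ac ?ca mul0r.
by move/eqP; rewrite -{1}[a]addr0 (inj_eq (addrI a)) eq_sym (negPf c0).
Qed.
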